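(* Let $(\Omega,d,\mu)$ be a metric measure space such that $\mu$ is $c$-almost continuous and $\alpha$-lower bounded, with $\mu(B(x,r))\ge r^{\alpha}$ for all $x\in\Omega$, $r>0$ (where $c\ge 1$, $\alpha>0$). Let $s>0$, let $f\in M^{s,L^{1}+L^{\infty}}(\Omega)$ and $g\in D^{s}(f)$. Let $0<p\le 1$. Then, for all $t>0$, $$\Big( (|f|^{p})^{**}(t)-(|f|^{p})^{*}(t)\Big)^{1/p}\le C\,t^{s/\alpha}\Big((g^{p})^{**}(t)\Big)^{1/p},$$ where $C=C(c,p)$ is a constant that just depends on $c$ and $p$.
   Context: A metric measure space $(\Omega,d,\mu)$ is a metric space $(\Omega,d)$ with a Borel measure $\mu$ such that $0<\mu(B)<\infty$ for every ball $B=B(x,r)=\{y\in\Omega: d(x,y)<r\}$; it is always assumed that $\mu(\Omega)=\infty$ and $\mu(\{x\})=0$ for all $x\in\Omega$. $\mu$ is $\alpha$-lower bounded if there are $b,\alpha>0$ with $\mu(B(x,r))\ge b r^{\alpha}$ for all $x\in\Omega$, $r>0$; for simplicity one takes $b=1$. $\mu$ is $c$-almost continuous ($c\ge1$) if for every $t>0$ and every $x\in\Omega$ there is $r(x)>0$ such that $t\le\mu(B(x,r(x)))\le c\,t$ (this holds, for some $c\ge 1$, if $r\mapsto\mu(B(x,r))$ is continuous for every $x$, or if $\mu$ is doubling, i.e. there is $C_D>1$ with $\mu(B(x,2r))\le C_D\,\mu(B(x,r))$ for all $x\in\Omega$, $r>0$). For measurable $f:\Omega\to\mathbb{R}$, $\mu_f(\lambda)=\mu\{x\in\Omega:|f(x)|>\lambda\}$,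 the decreasing rearrangement is $f^{*}(t)=\inf\{\lambda\ge0:\mu_f(\lambda)\le t\}$, and $f^{**}(t)=\frac1t\int_0^t f^{*}(z)\,dz$ for $t>0$. For a rearrangement invariant space $X$ on $\Omega$ (a Banach function space in which functions with the same decreasing rearrangement belong to $X$ together and have the same norm) and $s>0$, $f\in M^{s,X}(\Omega)$ means that $f\in X$ and there is a non-negative measurable $g\in X$ such that $$|f(x)-f(y)|\le d(x,y)^{s}(g(x)+g(y))\quad \mu\text{-a.e. }x,y\in\Omega.$$ A function $g$ satisfying this is called an $s$-gradient of $f$, and $D^{s}(f)$ denotes the collection of all $s$-gradients of $f$. Here $X=L^{1}(\Omega)+L^{\infty}(\Omega)$.
   Formalization: The claim with C depending only on c and p is false when s/α is unbounded; the formal theorem has the extra factor (1+s/α)^{1/p} on the right-hand side, with C still depending only on c and p. *)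

(* Defs.v *)
From HB Require Import structures.
From mathcomp Require Import all_boot all_order all_algebra.
From mathcomp Require Import all_classical all_reals all_analysis.

Set Implicit Arguments.
Unset Strict Implicit.
Unset Printing Implicit Defensive.

Import Order.TTheory GRing.Theory Num.Theory.
Import numFieldNormedType.Exports.

Local Open Scope classical_set_scope.
Local Open Scope ring_scope.

(* The join carries unrelated topological and measurable structures; that the
   measurable sets are the Borel sets is a clause of [metric_measure_space]. *)
#[short(type="metricMeasurableType")]
HB.structure Definition MetricMeasurable (K : numDomainType) d :=
  { T of Metric K T & Measurable d T }.

Section MetricMeasureSpaces.
Local Open Scope ereal_scope.
Context {R : realType} {d : measure_display} {T : metricMeasurableType R d}.
Variable mu : {measure set T -> \bar R}.

Definition metric_measure_space : Prop :=
  [/\ @measurable d T = <<s @open T >>,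
      forall (x : T) (r : R), (0 < r)%R -> 0 < mu (ball x r) < +oo,
      mu [set: T] = +oo
    & forall x : T, mu [set x] = 0].

(* The normalisation b = 1 of the lower bound mu (B(x, r)) >= b r^alpha. *)
Definition lower_bounded (alpha : R) : Prop :=
  forall (x : T) (r : R), (0 < r)%R -> (r `^ alpha)%:E <= mu (ball x r).

Definition almost_continuous (c : R) : Prop :=
  forall (t : R) (x : T), (0 < t)%R ->
    exists2 r : R, (0 < r)%R & t%:E <= mu (ball x r) <= (c * t)%:E.

(* Values are extended reals: the infimum is +oo when no level qualifies. *)
Definition rearrangement (f : T -> R) (t : R) : \bar R :=
  ereal_inf [set l%:E | l in
    [set l : R | (0 <= l)%R /\ mu [set x | (l < `|f x|)%R] <= t%:E]].

Definition maximal_rearrangement (f : T -> R) (t : R) : \bar R :=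
  t^-1%:E * \int[lebesgue_measure]_(z in `]0%R, t[) rearrangement f z.

Definition L1_plus_Loo : set (T -> R) :=
  [set f | exists f1 f2 : T -> R,
    [/\ f1 \in Lfun mu 1, f2 \in Lfun mu +oo & f = (f1 \+ f2)%R]].

(* "For a.e. x, y" means for all x, y outside a common null set. *)
Definition gradients (X : set (T -> R)) (s : R) (f : T -> R) : set (T -> R) :=
  [set g : T -> R | [/\ measurable_fun [set: T] g,
               forall x, (0 <= g x)%R,
               X g
             & exists2 N : set T, mu.-negligible N &
                 forall x y, ~ N x -> ~ N y ->
                   (`|f x - f y| <= mdist x y `^ s * (g x + g y))%R]].

Definition hajlasz_sobolev (X : set (T -> R)) (s : R) : set (T -> R) :=
  [set f : T -> R | [/\ measurable_fun [set: T] f, X f & gradients X s f !=set0]].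

End MetricMeasureSpaces.

(* Main.v *)
Require Import Defs.
From mathcomp Require Import all_boot all_order all_algebra.
From mathcomp Require Import all_classical all_reals all_analysis.
From mathcomp Require Import measurable_realfun ring lra.

Import Order.TTheory GRing.Theory Num.Theory.
Import numFieldNormedType.Exports.
Local Open Scope classical_set_scope.
Local Open Scope ring_scope.

(** The idea is that a point [x] at which [f] is large has, within distance
    about [t `^ alpha^-1], a point [y] at which both [f] and its gradient are
    under control, so that the gradient inequality at [(x, y)] bounds [f x].

    Since [p <= 1], raising to the power [p] is subadditive, so
    [F = `|f| `^ p] has [G = g `^ p] as a gradient of order [sigma = s * p]
    ([powR_hajlasz]), and the claim reduces to an estimate for [F] and [G]
    without exponents ([maximal_rearrangement_le_lower_bounded]).

    Write [F^*] for the rearrangement and [F^**] for its average.  Let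
    [q = 1 + s / alpha], [e = t / q] and [r = (t + e) `^ alpha^-1].  The lower
    bound gives every ball of radius [r] a measure at least [t + e].  The set
    where [F] exceeds [F^*(t)] has measure at most [t], the set where [G]
    exceeds [k = G^*(e / 2)] has measure at most [e / 2], and together with a
    null set they cannot cover the ball ([exists_good_point_in_ball]).  A point
    [y] of the ball that they miss yields, for almost every [x],
      [F x <= F^*(t) + r `^ sigma * (G x + k)].
    This inequality between functions passes to rearrangements and then to
    their averages ([le_maximal_rearrangement_affine]), so that
      [F^**(t) - F^*(t) <= r `^ sigma * (G^**(t) + k)].

    As [G^*] is nonincreasing, [k <= 2 * t / e * G^**(t) = 2 * q * G^**(t)].
    The excess [e] of the measure of the ball over [t] is the parameter to
    tune: a small [e] spoils this bound on [k] by a factor [t / e], a large one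
    spoils [r `^ sigma = (t + e) `^ (sigma / alpha)].  With [e = t / q] the
    latter is at most [expR 1 * t `^ (sigma / alpha)], since
    [(1 + q^-1) `^ q <= expR 1] and [sigma / alpha <= q], so the total loss is
    linear in [q].  A root of order [p] then gives the theorem. *)

(** * Powers of real numbers *)

(** For [0 <= z <= a + b] the ratio [z / (a + b)] lies in [[0, 1]], hence is at
    most its own power [p]; the two ratios for [z = a] and [z = b] add to 1. *)
Lemma powR_subadditive (R : realType) (p a b : R) :
  0 < p -> p <= 1 -> 0 <= a -> 0 <= b ->
  (a + b) `^ p <= a `^ p + b `^ p.
Proof.
move=> p0 p1 a0 b0.
have [ab0|ab0] := leP (a + b) 0.
  have -> : a = 0 by lra.
  have -> : b = 0 by lra.
  by rewrite add0r powR0 ?gt_eqF// addr0.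
have ratio_le z : 0 <= z -> z <= a + b ->
    z / (a + b) * (a + b) `^ p <= z `^ p.
  move=> z0 zab; have [->|zn0] := eqVneq z 0; first by rewrite !mul0r powR_ge0.
  have zp : 0 < z by rewrite lt_neqAle eq_sym zn0.
  rewrite -{2}(@divfK _ (a + b) _ z) ?gt_eqF// powRM ?divr_ge0 ?(ltW ab0)//.
  rewrite ler_wpM2r ?powR_ge0// ger1_powR// divr_gt0//= ler_pdivrMr//.
  by rewrite mul1r.
have := lerD (ratio_le a a0 _) (ratio_le b b0 _).
rewrite -mulrDl -mulrDl divff ?gt_eqF// mul1r; apply; lra.
Qed.

(** This is how a gradient inequality survives the power [p <= 1], with
    [u = f x], [v = f y], [a = g x], [b = g y] and [w] a power of the distance.
    The absolute value of a difference disappears from the conclusion, since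
    only an upper bound for [`|f x|] is used later. *)
Lemma powR_hajlasz (R : realType) (p u v w a b : R) :
  0 < p -> p <= 1 -> 0 <= w -> 0 <= a -> 0 <= b ->
  `|u - v| <= w * (a + b) ->
  `|u| `^ p <= `|v| `^ p + w `^ p * (a `^ p + b `^ p).
Proof.
move=> p0 p1 w0 a0 b0 uv; have pge0 := ltW p0.
apply: (@le_trans _ _ ((`|v| + `|u - v|) `^ p)).
  apply: ge0_ler_powR; rewrite ?nnegrE ?addr_ge0//.
  by rewrite -{1}(subrK v u) addrC ler_normD.
apply: le_trans (powR_subadditive _ _ _ _ p0 p1 _ _) _ => //.
rewrite lerD2l; apply: (@le_trans _ _ ((w * (a + b)) `^ p)).
  by apply: ge0_ler_powR; rewrite ?nnegrE// mulr_ge0// addr_ge0.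
rewrite powRM ?addr_ge0// ler_wpM2l ?powR_ge0//.
exact: powR_subadditive.
Qed.

Lemma powR_le_expR (R : realType) (a q : R) : 0 < q -> 0 <= a -> a <= q ->
  (1 + q^-1) `^ a <= expR 1.
Proof.
move=> q0 a0 aq.
have qV0 : 0 < q^-1 by rewrite invr_gt0.
have q1 : 0 < 1 + q^-1 by lra.
rewrite /powR gt_eqF// ler_expR -[leRHS](@divff _ q) ?gt_eqF//.
apply: ler_pM => //; first by rewrite ln_ge0// lerDl ltW.
by apply: le_ln1Dx; lra.
Qed.

(** * Rearrangements and their averages *)

Section Rearrangement.
Context {R : realType} {d : measure_display} {T : metricMeasurableType R d}.
Variable mu : {measure set T -> \bar R}.
Implicit Types (f g : T -> R) (t u : R).

Lemma measurable_superlevel f (l : R) :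
  measurable_fun [set: T] f -> measurable [set x | l < `|f x|].
Proof.
move=> mf; rewrite -[X in measurable X]setTI.
rewrite (_ : [set x | _] = (Num.norm \o f) @^-1` `]l, +oo[).
  exact: (measurableT_comp (@normr_measurable R setT) mf).
by apply/seteqP; split => x /=; rewrite in_itv/= andbT.
Qed.

Local Open Scope ereal_scope.

Lemma rearrangement_ge0 f t : 0 <= rearrangement mu f t.
Proof. by apply: le_ereal_inf_tmp => _ [l [l0 _] <-]; rewrite lee_fin. Qed.

Lemma maximal_rearrangement_ge0 f t : (0 < t)%R ->
  0 <= maximal_rearrangement mu f t.
Proof.
move=> t0; rewrite mule_ge0 ?lee_fin ?invr_ge0 ?(ltW t0)//.
by apply: integral_ge0 => z _; exact: rearrangement_ge0.
Qed.

Lemma rearrangement_nonincreasing f t u : (t <= u)%R ->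
  rearrangement mu f u <= rearrangement mu f t.
Proof.
move=> tu; apply: ereal_inf_le_tmp => _ [l [l0 lt] <-]; exists l => //.
by split=> //; rewrite (le_trans lt)// lee_fin.
Qed.

(** Superlevel sets of a nonincreasing function are intervals. *)
Lemma measurable_rearrangement f (D : set (measurableTypeR R)) :
  measurable_fun D (rearrangement mu f : measurableTypeR R -> \bar R).
Proof.
move=> mD; apply: (measurability _ (ErealGenOInfty.measurableE R)) => //.
move=> _ [_ [l ->]] <-; apply: measurableI => //.
apply: is_interval_measurable => s t /=; rewrite !in_itv/= !andbT => _ lt.
move=> u /andP[_ ut]; rewrite in_itv/= andbT (lt_le_trans lt)//.
exact: rearrangement_nonincreasing.
Qed.

(** The infimum defining a finite rearrangement is attained: [{ |f| > l }] is
    the increasing union of the sets [{ |f| > l + 1 / n }], each of which has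
    measure at most [t] because [l + 1 / n] exceeds the infimum. *)
Lemma mu_superlevel_rearrangement f t (l : R) : measurable_fun [set: T] f ->
  rearrangement mu f t = l%:E -> mu [set x | (l < `|f x|)%R] <= t%:E.
Proof.
move=> mf fl.
pose S n := [set x | (l + n.+1%:R^-1 < `|f x|)%R].
have mS n : measurable (S n) by exact: measurable_superlevel.
have -> : [set x | (l < `|f x|)%R] = \bigcup_n S n.
  apply/seteqP; split => [x /= lx|x [n _] /=].
    have [n ln] := ltr_add_invr lx.
    by exists n.
  by apply: lt_trans; rewrite ltrDl.
have muS n : mu (S n) <= t%:E.
  have : rearrangement mu f t < (l + n.+1%:R^-1)%:E by rewrite fl lte_fin ltrDl.
  move=> /ereal_inf_lt[_ [m [m0 mt] <-]]; rewrite lte_fin => mln.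
  apply: le_trans mt; apply: le_measure; rewrite ?inE//.
    exact: measurable_superlevel.
  by move=> x; exact: lt_trans.
have cvgS : mu \o S @ \oo --> mu (\bigcup_n S n).
  apply: nondecreasing_cvg_mu => //; first exact: bigcup_measurable.
  move=> n m nm; apply/subsetPset => x /=; apply: le_lt_trans.
  by rewrite lerD2l lef_pV2 ?posrE// ler_nat ltnS.
rewrite -(cvg_lim _ cvgS)//; apply: lime_le.
  by apply/cvg_ex; eexists; exact: cvgS.
by near=> n; exact: muS.
Unshelve. all: by end_near. Qed.

(** A level [l] admissible for [g] makes [a + A * l] admissible for [f], up to
    the null set [N]. *)
Lemma le_rearrangement_affine f g (N : set T) (a A : R) t :
  measurable_fun [set: T] f -> measurable_fun [set: T] g ->
  (0 <= a)%R -> (0 < A)%R -> mu.-negligible N ->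
  (forall x, ~ N x -> (`|f x| <= a + A * `|g x|)%R) ->
  rearrangement mu f t <= a%:E + A%:E * rearrangement mu g t.
Proof.
move=> mf mg a0 A0 [M [mM M0 NM]] fg.
have := rearrangement_ge0 g t.
case gt : (rearrangement mu g t) => [l| |]; rewrite ?lee_fin => l0.
- rewrite -EFinM -EFinD; apply: ge_ereal_inf; exists (a + A * l)%:E => //.
  exists (a + A * l)%R => //; split; first by rewrite addr_ge0// mulr_ge0// ltW.
  apply: (le_trans _ (mu_superlevel_rearrangement g t l mg gt)).
  rewrite -[leRHS]adde0 -M0.
  have mgl := measurable_superlevel g l mg.
  apply: le_trans (measureU2 _ mgl mM).
  apply: le_measure; rewrite ?inE//.
  + exact: measurable_superlevel.
  + exact: measurableU.
  + move=> x /= fx; have [Nx|Nx] := pselect (N x); [by right; exact: NM|left].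
    have := lt_le_trans fx (fg _ Nx).
    by rewrite ltrD2l ltr_pM2l.
- by rewrite gt0_muley ?lte_fin// addey// leey.
- by [].
Qed.

Lemma lebesgue_measure_0itv t : (0 < t)%R ->
  lebesgue_measure (`]0%R, t[%classic : set R) = t%:E.
Proof. by move=> t0; rewrite lebesgue_measure_itv/= lte_fin t0 sube0. Qed.

(** Averaging a nonincreasing function: its value at [u] is at most its average
    over ]0, u[, and enlarging the interval to ]0, t[ costs the factor [t / u]. *)
Lemma rearrangement_le_maximal f t u : (0 < u)%R -> (u <= t)%R ->
  rearrangement mu f u <= (t / u)%:E * maximal_rearrangement mu f t.
Proof.
move=> u0 ut; have t0 := lt_le_trans u0 ut.
rewrite /maximal_rearrangement muleA -EFinM.
rewrite (_ : t / u * t^-1 = u^-1)%R; last by field; rewrite !gt_eqF.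
rewrite -[leLHS]mul1e -(@mulVf _ u) ?gt_eqF// EFinM -muleA.
rewrite lee_pmul2l ?lte_fin ?invr_gt0//.
rewrite muleC -(lebesgue_measure_0itv u u0) -integral_cst//.
apply: (@le_trans _ _
  (\int[lebesgue_measure]_(z in `]0%R, u[) rearrangement mu f z)).
  apply: ge0_le_integral => //.
  - by move=> z _; exact: rearrangement_ge0.
  - exact: measurable_rearrangement.
  - move=> z /=; rewrite in_itv/= => /andP[_ zu].
    by apply: rearrangement_nonincreasing; exact: ltW.
apply: ge0_subset_integral => //.
- exact: measurable_rearrangement.
- by move=> z _; exact: rearrangement_ge0.
- by apply: subset_itvl; rewrite bnd_simp.
Qed.

Lemma le_maximal_rearrangement_affine f g (N : set T) (a A : R) t :
  measurable_fun [set: T] f -> measurable_fun [set: T] g ->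
  (0 <= a)%R -> (0 < A)%R -> mu.-negligible N ->
  (forall x, ~ N x -> (`|f x| <= a + A * `|g x|)%R) -> (0 < t)%R ->
  maximal_rearrangement mu f t <= a%:E + A%:E * maximal_rearrangement mu g t.
Proof.
move=> mf mg a0 A0 N0 fg t0; rewrite /maximal_rearrangement.
have Mge0 := @rearrangement_ge0; have Mm := @measurable_rearrangement.
have -> : a%:E + A%:E * (t^-1%:E *
      \int[lebesgue_measure]_(z in `]0%R, t[) rearrangement mu g z)
  = t^-1%:E * \int[lebesgue_measure]_(z in `]0%R, t[)
      (a%:E + A%:E * rearrangement mu g z).
  rewrite ge0_integralD//; last 2 first.
  - by move=> z _; rewrite mule_ge0// lee_fin ltW.
  - exact: measurable_funeM.
  have -> : \int[lebesgue_measure]_(z in `]0%R, t[) a%:E = (a * t)%:E.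
    rewrite EFinM -(lebesgue_measure_0itv t t0); exact: integral_cst.
  rewrite ge0_integralZl//; last by rewrite lee_fin ltW.
  have : 0 <= \int[lebesgue_measure]_(z in `]0%R, t[) rearrangement mu g z.
    exact: integral_ge0.
  (* The integral unfolds to a difference, on which distributivity could
     otherwise be rewritten. *)
  move: (\int[_]_(_ in _) _) => I I0.
  rewrite ge0_muleDr ?lee_fin ?mulr_ge0 ?(ltW t0)//; last first.
    by rewrite mule_ge0 ?lee_fin ?(ltW A0).
  by rewrite -EFinM mulrCA mulVf ?gt_eqF// mulr1 muleCA.
rewrite lee_pmul2l ?lte_fin ?invr_gt0//.
apply: ge0_le_integral => //.
- apply: emeasurable_funD => //; exact: measurable_funeM.
- by move=> z _; exact: le_rearrangement_affine N0 fg.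
Qed.

End Rearrangement.

(** * Oscillation on balls of controlled measure *)

Section OscillationEstimate.
Context {R : realType} {d : measure_display} {T : metricMeasurableType R d}.
Variable mu : {measure set T -> \bar R}.

Lemma measurable_ball_metric_measure_space (x : T) (r : R) :
  metric_measure_space mu -> measurable (ball x r).
Proof.
move=> [borel _ _ _]; rewrite borel; apply: sub_sigma_algebra.
rewrite openE => y; rewrite ballEmdist/= => xy.
apply/nbhs_ballP; exists (r - mdist x y); first by rewrite /= subr_gt0.
move=> z /=; rewrite !ballEmdist/= ltrBrDl; apply: le_lt_trans.
exact: metric_triangle.
Qed.

(** The radius is the one at which the lower bound forces the ball around [x]
    to have measure at least [a + e], more than the total [a + e / 2] of the
    exceptional sets. *)
Lemma exists_good_point_in_ball (alpha a e l k : R) (F G : T -> R)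
    (N : set T) (x : T) :
  metric_measure_space mu -> lower_bounded mu alpha -> 0 < alpha ->
  measurable_fun [set: T] F -> measurable_fun [set: T] G ->
  mu.-negligible N ->
  0 <= a -> 0 < e ->
  (mu [set y | (l < `|F y|)%R] <= a%:E)%E ->
  (mu [set y | (k < `|G y|)%R] <= (e / 2)%:E)%E ->
  exists y, [/\ ~ N y, mdist x y < (a + e) `^ alpha^-1,
    `|F y| <= l & `|G y| <= k].
Proof.
move=> mms lb al0 mF mG [M [mM M0 NM]] a0 e0 Fa Ge.
have ae0 : 0 < a + e by lra.
pose r := (a + e) `^ alpha^-1.
have r0 : 0 < r by exact: powR_gt0.
have mB := measurable_ball_metric_measure_space x r mms.
have mSF := measurable_superlevel F l mF.
have mSG := measurable_superlevel G k mG.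
have muB : ((a + e)%:E <= mu (ball x r))%E.
  have := lb x r r0.
  by rewrite /r -powRrM mulVf ?gt_eqF// powRr1// ltW.
apply: contrapT => /forallNP noy.
have : (mu (ball x r) <= (a + e / 2)%:E)%E.
  rewrite EFinD -[leRHS]adde0 -M0.
  apply: (@le_trans _ _
    (mu ([set y | (l < `|F y|)%R] `|` [set y | (k < `|G y|)%R] `|` M))).
    apply: le_measure; rewrite ?inE//.
      by do 2 apply: measurableU => //.
    move=> y; rewrite ballEmdist/= => xy.
    have [Ny|Ny] := pselect (N y); first by right; exact: NM.
    left; have [ly|yl] := ltP l `|F y|; first by left.
    right; rewrite ltNge; apply/negP => yk.
    by apply: (noy y); split.
  apply: le_trans (measureU2 _ _ _) _ => //; first exact: measurableU.
  apply: leeD => //; apply: le_trans (measureU2 _ _ _) _ => //.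
  exact: leeD.
by move=> /(le_trans muB); rewrite lee_fin => ?; lra.
Qed.

(** The case [p = 1] of the theorem, for a one-sided gradient inequality.  The
    parameter [q] is free above [1] and [sigma / alpha] because the theorem
    applies this with [sigma = s * p] but measures the loss by
    [1 + s / alpha].  With [F^*(t)] on the right-hand side, the cases of
    infinite [F^*(t)] or [G^**(t)] are trivial. *)
Lemma maximal_rearrangement_le_lower_bounded (alpha sigma q t : R)
    (F G : T -> R) (N : set T) :
  metric_measure_space mu -> lower_bounded mu alpha -> 0 < alpha ->
  0 <= sigma -> 1 <= q -> sigma / alpha <= q -> 0 < t ->
  measurable_fun [set: T] F -> measurable_fun [set: T] G ->
  mu.-negligible N ->
  (forall x y, ~ N x -> ~ N y ->
    `|F x| <= `|F y| + mdist x y `^ sigma * (`|G x| + `|G y|)) ->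
  (maximal_rearrangement mu F t <= rearrangement mu F t +
     (3 * expR 1 * q * t `^ (sigma / alpha))%:E
       * maximal_rearrangement mu G t)%E.
Proof.
move=> mms lb al0 sigma0 q1 sq t0 mF mG N0 FG.
pose e1 : R := expR 1; rewrite -/e1.
have e10 : 0 < e1 by exact: expR_gt0.
have q0 : 0 < q by lra.
have sa0 : 0 <= sigma / alpha by rewrite divr_ge0// ltW.
pose D := 3 * e1 * q * t `^ (sigma / alpha); rewrite -/D.
have D0 : 0 < D by rewrite !mulr_gt0 ?powR_gt0.
have := maximal_rearrangement_ge0 mu G t t0.
case Gm : (maximal_rearrangement mu G t) => [m| |] // m0; last first.
  rewrite gt0_muley ?lte_fin// addey ?leey//.
  by have := rearrangement_ge0 mu F t; case: (rearrangement mu F t).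
rewrite lee_fin in m0.
have := rearrangement_ge0 mu F t.
case Fl : (rearrangement mu F t) => [l| |] // l0; last first.
  by rewrite -EFinM addye ?leey.
rewrite lee_fin in l0.
pose e := t / q.
have e0 : 0 < e by rewrite divr_gt0.
have e20 : 0 < e / 2 by lra.
have et : e / 2 <= t.
  by rewrite /e ler_pdivrMr// ler_pdivrMr//; nra.
have Gk0 := rearrangement_le_maximal mu G t (e / 2) e20 et.
have := Gk0.
case Gk : (rearrangement mu G (e / 2)) => [k| |]; rewrite Gm -EFinM // => {Gk0};
  last first.
  by have := rearrangement_ge0 mu G (e / 2); rewrite Gk.
rewrite lee_fin => km.
have k0 : 0 <= k by rewrite -lee_fin -Gk; exact: rearrangement_ge0.
pose r := (t + e) `^ alpha^-1.
pose A := r `^ sigma.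
have te0 : 0 < t + e by lra.
have r0 : 0 < r by exact: powR_gt0.
have A0 : 0 < A by exact: powR_gt0.
have FAG x : ~ N x -> `|F x| <= (l + A * k) + A * `|G x|.
  move=> Nx.
  have [y [Ny xy Fy Gy]] := exists_good_point_in_ball alpha t e l k F G N x
    mms lb al0 mF mG N0 (ltW t0) e0
    (mu_superlevel_rearrangement mu F t l mF Fl)
    (mu_superlevel_rearrangement mu G (e / 2) k mG Gk).
  have dA : mdist x y `^ sigma * (`|G x| + `|G y|) <= A * (`|G x| + `|G y|).
    rewrite ler_wpM2r ?addr_ge0//.
    by apply: ge0_ler_powR; rewrite ?nnegrE ?mdist_ge0 ?(ltW r0) ?(ltW xy).
  have := FG x y Nx Ny; have := ler_wpM2l (ltW A0) Gy.
  lra.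
have lAk0 : 0 <= l + A * k by rewrite addr_ge0// mulr_ge0// ltW.
apply: le_trans (le_maximal_rearrangement_affine mu F G N (l + A * k) A t
  mF mG lAk0 A0 N0 FAG t0) _.
rewrite Gm -!EFinM -!EFinD lee_fin.
have AD : A <= e1 * t `^ (sigma / alpha).
  have -> : A = t `^ (sigma / alpha) * (1 + q^-1) `^ (sigma / alpha).
    rewrite -powRM ?(ltW t0) ?addr_ge0 ?invr_ge0 ?(ltW q0)//.
    by rewrite /A /r -powRrM mulrDr mulr1; congr (_ `^ _); ring.
  by rewrite mulrC ler_wpM2r ?powR_ge0// powR_le_expR.
(* [t / (e / 2) = 2 * q] *)
have kq : k <= 2 * q * m.
  apply: le_trans km _; rewrite /e le_eqVlt; apply/orP; left; apply/eqP.
  by field; rewrite !gt_eqF.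
have Ak := ler_wpM2l (ltW A0) kq.
(* With [1 <= q], [A * (m + k)] is at most [A * (1 + 2 * q) * m], hence at most
   [3 * A * q * m], which is the origin of the constant 3. *)
have ADqm : A * (q * m) <= e1 * t `^ (sigma / alpha) * (q * m).
  by rewrite ler_wpM2r// mulr_ge0// ltW.
have Am : A * m <= A * (q * m).
  by rewrite ler_wpM2l ?(ltW A0)// ler_peMl.
have -> : D * m = 3 * (e1 * t `^ (sigma / alpha) * (q * m)) by rewrite /D; ring.
lra.
Qed.

End OscillationEstimate.

(** * The oscillation of the rearrangement *)

(* C is chosen from c and p alone.  The factor (1 + s/alpha)^(1/p) cannot be
   dropped: glue [0, 1] to [0, +oo[ by dist e x = 1 + x, with Lebesgue measure,
   so that c = 2 and alpha = 1, and take f = \1_[0, 1], g x = (1 + x) `^ (- s)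
   on [0, +oo[ and 0 elsewhere, p = t = 1: the left-hand side is 1, while the
   average of g^* over ]0, 1[ is at most 1 / (s - 1) for s > 1. *)
Theorem theorem4 (R : realType) (c p : R) (c1 : 1 <= c) (p0 : 0 < p)
    (p1 : p <= 1) :
  exists C : R, 0 < C /\
    forall (d : measure_display) (Omega : metricMeasurableType R d)
      (mu : {measure set Omega -> \bar R}) (alpha s : R) (f g : Omega -> R),
      metric_measure_space mu ->
      almost_continuous mu c ->
      0 < alpha -> lower_bounded mu alpha ->
      0 < s ->
      hajlasz_sobolev mu (L1_plus_Loo mu) s f ->
      gradients mu (L1_plus_Loo mu) s f g ->
      forall t : R, 0 < t ->
        (poweR (maximal_rearrangement mu (fun x => `|f x| `^ p)%R t
                - rearrangement mu (fun x => `|f x| `^ p)%R t) p^-1%R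
         <= (C * (1 + s / alpha) `^ p^-1 * t `^ (s / alpha))%R%:E
            * poweR (maximal_rearrangement mu (fun x => g x `^ p)%R t) p^-1%R)%E.
Proof.
pose e1 : R := expR 1.
have e10 : 0 < e1 by exact: expR_gt0.
exists ((3 * e1) `^ p^-1); split; first by rewrite powR_gt0// mulr_gt0.
move=> d Omega mu alpha s f g mms _ al0 lb s0 [mf _ _].
move=> [mg g0 _ [N N0 fg]] t t0.
have pV0 : 0 < p^-1 by rewrite invr_gt0.
pose F x := `|f x| `^ p; pose G x := g x `^ p.
rewrite -/F -/G.
have sa0 : 0 < s / alpha by rewrite divr_gt0.
pose q := 1 + s / alpha; rewrite -/q.
have q0 : 0 < q by rewrite /q; lra.
pose D := 3 * e1 * q * t `^ (s * p / alpha).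
have D0 : 0 < D by rewrite !mulr_gt0 ?powR_gt0.
have -> : (3 * e1) `^ p^-1 * q `^ p^-1 * t `^ (s / alpha) = D `^ p^-1.
  rewrite /D [RHS]powRM ?powR_ge0// ?mulr_ge0 ?(ltW e10) ?(ltW q0)//.
  rewrite [X in _ = X * _]powRM ?mulr_ge0 ?(ltW e10) ?(ltW q0)//.
  rewrite -[X in _ = _ * X]powRrM; congr (_ * _ `^ _).
  by field; rewrite !gt_eqF.
have MG0 : (0 <= maximal_rearrangement mu G t)%E.
  exact: maximal_rearrangement_ge0.
rewrite -poweR_EFin -poweRM ?lee_fin ?(ltW D0)//.
have mF : measurable_fun [set: Omega] F.
  apply: (measurableT_comp (f := @powR R ^~ p)); first exact: measurable_powR.
  exact: (measurableT_comp (@normr_measurable R setT)).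
have mG : measurable_fun [set: Omega] G.
  by apply: (measurableT_comp (f := @powR R ^~ p)); first exact: measurable_powR.
have osc : (maximal_rearrangement mu F t <=
    rearrangement mu F t + D%:E * maximal_rearrangement mu G t)%E.
  have spq : s * p / alpha <= q.
    apply: (@le_trans _ _ (s / alpha)); last by rewrite /q lerDr.
    by rewrite mulrAC ler_piMr ?(ltW sa0).
  apply: maximal_rearrangement_le_lower_bounded N0 _ => //.
  - by rewrite mulr_ge0 ?(ltW s0) ?(ltW p0).
  - by rewrite /q lerDl ltW.
  - move=> x y Nx Ny; rewrite !(ger0_norm (powR_ge0 _ _)) powRrM.
    by apply: powR_hajlasz; rewrite ?powR_ge0 ?fg.
(* [poweR] sends negative reals to 1 and [-oo] to 0: the difference must be
   shown to be nonnegative, unless [F^*(t)] is infinite. *)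
case Fl : (rearrangement mu F t) osc => [l| |] osc; last 2 first.
- by rewrite addeNy poweRNyr ?gt_eqF// poweR_ge0.
- by have := rearrangement_ge0 mu F t; rewrite Fl.
have diff0 : (0 <= maximal_rearrangement mu F t - l%:E)%E.
  have := rearrangement_le_maximal mu F t t t0 (lexx t).
  by rewrite Fl divff ?gt_eqF// mul1e => lM; rewrite sube_ge0.
have main : (maximal_rearrangement mu F t - l%:E
             <= D%:E * maximal_rearrangement mu G t)%E by rewrite leeBlDl.
apply: (gt0_ler_poweR (ltW pV0)) main; rewrite in_itv/= leey andbT//.
by rewrite mule_ge0// lee_fin ltW.
Qed.
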